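(* Let $A$ be an $m\times n$ matrix with entries in $\{0,1\}$. Regard each row and each column of $A$ as a binary string read from its first entry (row index $0$ / column index $0$) onward, and fix one lexicographic order on such strings, used for both rows and columns (for instance the reverse order in which $1$ precedes $0$). Consider the process that alternately (i) permutes the rows of the current matrix so that they appear in sorted order and (ii) permutes the columns of the current matrix so that they appear in sorted order. Then after finitely many steps the process reaches a fixed point, i.e. a matrix whose rows and columns are simultaneously sorted. The same conclusion holds if the set of row positions and the set of column positions are each partitioned into parts and each sorting step only rearranges rows (respectively columns) among the positions of the same part, sorting them within that part, so that no row or column moves across parts.
   Context: Sorting rows means reordering the rows so that they are in (weakly) monotone order with respect to the fixed lexicographic order; similarly for columns. *)

(* Defs.v *)
From mathcomp Require Import all_boot all_order all_fingroup all_algebra.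

Set Implicit Arguments.
Unset Strict Implicit.
Unset Printing Implicit Defensive.

(* Letters 0 and 1 are [false] and [true].  There are two lexicographic       *)
(* orders on binary strings, one for each order of the letters: 0 before 1    *)
(* when [rev] is false, and 1 before 0 when [rev] is true.  Sorting in        *)
(* nonincreasing order for one of them is sorting in nondecreasing order for  *)
(* the other, as all the strings compared have the same length.               *)
Definition lex_le (rev : bool) (n : nat) (s t : n.-tuple bool) : bool :=
  if rev then ((s : n.-tuplelexi (bool^d)%type) <= (t : n.-tuplelexi (bool^d)%type))%O
  else ((s : n.-tuplelexi bool) <= (t : n.-tuplelexi bool))%O.

Definition row_string (m n : nat) (A : 'M[bool]_(m, n)) (i : 'I_m) :
  n.-tuple bool := [tuple A i j | j < n].

Definition col_string (m n : nat) (A : 'M[bool]_(m, n)) (j : 'I_n) :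
  m.-tuple bool := [tuple A i j | i < m].

(* The relation [e] tells which positions may be exchanged with each other;   *)
(* order is only required between such positions, which need not be           *)
(* contiguous.                                                                *)
Definition rows_sorted (rev : bool) (m n : nat) (e : rel 'I_m)
    (A : 'M[bool]_(m, n)) : Prop :=
  forall i i' : 'I_m, e i i' -> i <= i' ->
    lex_le rev (row_string A i) (row_string A i').

Definition cols_sorted (rev : bool) (m n : nat) (e : rel 'I_n)
    (A : 'M[bool]_(m, n)) : Prop :=
  forall j j' : 'I_n, e j j' -> j <= j' ->
    lex_le rev (col_string A j) (col_string A j').

Definition row_sort_step (rev : bool) (m n : nat) (e : rel 'I_m)
    (A B : 'M[bool]_(m, n)) : Prop :=
  exists s : 'S_m, [/\ forall i, e i (s i), B = row_perm s A
                     & rows_sorted rev e B].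

Definition col_sort_step (rev : bool) (m n : nat) (e : rel 'I_n)
    (A B : 'M[bool]_(m, n)) : Prop :=
  exists s : 'S_n, [/\ forall j, e j (s j), B = col_perm s A
                     & cols_sorted rev e B].

(* [X k] is the matrix obtained after [k] steps. *)
Definition sorting_process (rev : bool) (m n : nat)
    (er : rel 'I_m) (ec : rel 'I_n)
    (A : 'M[bool]_(m, n)) (X : nat -> 'M[bool]_(m, n)) : Prop :=
  X 0 = A /\
  forall k, if odd k then col_sort_step rev ec (X k) (X k.+1)
            else row_sort_step rev er (X k) (X k.+1).

(* The first conjunct says that every sorting step can be carried out, so     *)
(* that the second one is not vacuous.                                        *)
Definition sorting_reaches_fixpoint (rev : bool) (m n : nat)
    (er : rel 'I_m) (ec : rel 'I_n) (A : 'M[bool]_(m, n)) : Prop :=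
  (exists X, sorting_process rev er ec A X) /\
  forall X, sorting_process rev er ec A X ->
    exists N, [/\ rows_sorted rev er (X N), cols_sorted rev ec (X N)
                & forall k, N <= k -> X k = X N].

Definition any_position (n : nat) : rel 'I_n := fun _ _ => true.

Definition same_part (n : nat) (P : {set {set 'I_n}}) : rel 'I_n :=
  fun i i' => i' \in pblock P i.

(* Main.v *)
Require Import Defs.
From mathcomp Require Import all_boot all_order all_fingroup all_algebra.
From mathcomp Require Import zify.
From Stdlib Require Import Classical.

(* Give the entry (i, j) the weight 2^(m-1-i) * 2^(n-1-j), and let Phi be the   *)
(* total weight of the entries carrying the larger letter.  Grouped by rows,    *)
(* Phi is the sum of the 2^(m-1-i) times the number coded by row i, and the     *)
(* order of these numbers is the lexicographic order of the rows.  By           *)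
(* rearrangement, sorting the rows within parts minimises Phi over the          *)
(* permutations that preserve the parts, and Phi drops unless the rows were     *)
(* already sorted.  Phi is invariant under transposition, so the same holds     *)
(* for columns.  The natural number Phi can drop only finitely often.           *)

Set Implicit Arguments.
Unset Strict Implicit.
Unset Printing Implicit Defensive.

(** [lex_code] reads a string as a binary number; xor with [rev] makes the larger letter the digit
    1, and [lex_leE] turns lexicographic order into the order of numbers. [sort_moment] is the
    rearrangement step: sorting never raises the potential, and keeps it only if nothing changes.
    [potential_tr] transfers this to columns. Once the potential is constant the matrix is too, and
    it is then the output of both a row sort and a column sort. The parts enter only as the classes
    of an equivalence relation. *)

Definition lex_code (rev : bool) (s : seq bool) : nat :=
  \sum_(j < size s) (nth false s j (+) rev) * 2 ^ (size s - j.+1).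

Lemma lex_code_cons rev x s :
  lex_code rev (x :: s) = (x (+) rev) * 2 ^ size s + lex_code rev s.
Proof. by rewrite /lex_code big_ord_recl /= subn1. Qed.

(** This is why later digits cannot outweigh an earlier one, so the first difference decides a
    comparison. *)
Lemma lex_code_lt rev s : lex_code rev s < 2 ^ size s.
Proof.
elim: s => [|x s IHs]; first by rewrite /lex_code big_ord0.
rewrite lex_code_cons /= expnS; case: (x (+) rev); lia.
Qed.

Lemma lex_code_inj rev s t :
  size s = size t -> lex_code rev s = lex_code rev t -> s = t.
Proof.
elim: s t => [|x s IHs] [|y t] //= [eq_sz].
have := lex_code_lt rev s; have := lex_code_lt rev t.
rewrite !lex_code_cons eq_sz => lt_t lt_s eq_c.
have eq_xy : x = y.
  by move: eq_c; case: x y rev lt_t lt_s {IHs} => [] [] [] /=; lia.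
by rewrite eq_xy in eq_c *; rewrite (IHs t) //; lia.
Qed.

Lemma lex_leE rev n (s t : n.-tuple bool) :
  lex_le rev s t = (lex_code rev s <= lex_code rev t).
Proof.
(* The induction runs on sequences; the order on tuples is that of the underlying sequences. *)
have code_le (u v : seq bool) : size u = size v ->
    (if rev then ((u : seqlexi (bool^d)%type) <= (v : seqlexi (bool^d)%type))%O
     else ((u : seqlexi bool) <= (v : seqlexi bool))%O)
    = (lex_code rev u <= lex_code rev v).
  elim: u v => [|x u IHu] [|y v] //=; first by rewrite leqnn; case: rev.
  case=> eq_sz; rewrite !Order.SeqLexiOrder.Exports.lexi_cons.
  have := lex_code_lt rev u; have := lex_code_lt rev v.
  rewrite !lex_code_cons eq_sz.
  by case: rev x y IHu => [] [] [] IHu lt_v lt_u /=; rewrite ?IHu //; lia.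
by rewrite -(code_le s t) ?size_tuple // /lex_le; case: rev {code_le}.
Qed.

(** * Rearrangement inequality within the classes of an equivalence relation *)

Section Rearrangement.

Variables (m : nat) (e : rel 'I_m).
Hypothesis eE : equivalence_rel e.

Definition sorted_in (g : 'I_m -> nat) : Prop :=
  forall i i' : 'I_m, e i i' -> i <= i' -> g i <= g i'.

(** The weights decrease strictly, as the exchange argument requires; powers of two match the digit
    weights of [lex_code], which makes the potential symmetric in rows and columns. *)
Definition moment (g : 'I_m -> nat) : nat := \sum_(i < m) 2 ^ (m - i.+1) * g i.

Let e_refl : reflexive e. Proof. by case/equivalence_relP: eE. Qed.
Let e_ltrans : left_transitive e. Proof. by case/equivalence_relP: eE. Qed.

(** Ties leave the sorting permutation free, but each class keeps its multiset of values, and a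
    sorted list is determined by its multiset. *)
Lemma sorted_in_unique (g : 'I_m -> nat) (s t : 'S_m) :
  (forall i, e i (s i)) -> (forall i, e i (t i)) ->
  sorted_in (g \o s) -> sorted_in (g \o t) -> g \o s =1 g \o t.
Proof.
move=> es et gs_sorted gt_sorted k.
(* The class of [k], listed in increasing order. *)
pose r := [seq i <- enum 'I_m | e k i].
have r_sorted (h : 'I_m -> nat) : sorted_in h -> sorted leq (map h r).
  move=> h_sorted; rewrite sorted_map.
  have: sorted (relpre val leq) r.
    apply: sorted_filter; first by move=> ? ? ?; exact: leq_trans.
    by rewrite -sorted_map val_enum_ord; exact: iota_sorted.
  apply: (sub_in_sorted (P := e k)) => [i j ki kj|]; last exact: filter_all.
  by apply: h_sorted; rewrite -(e_ltrans ki).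
have r_perm (u : 'S_m) : (forall i, e i (u i)) -> perm_eq (map u r) r.
  move=> eu; apply: uniq_perm.
  - by rewrite (map_inj_uniq perm_inj) filter_uniq ?enum_uniq.
  - by rewrite filter_uniq ?enum_uniq.
  move=> i; rewrite mem_filter mem_enum andbT.
  have e_sym : symmetric e.
    by move=> a b; apply/idP/idP => /e_ltrans <-.
  apply/mapP/idP => [[j]|ki].
    by rewrite mem_filter => /andP[kj _] ->; rewrite (e_ltrans kj).
  exists ((u^-1)%g i); last by rewrite permKV.
  rewrite mem_filter mem_enum andbT (e_ltrans ki) e_sym.
  by have := eu ((u^-1)%g i); rewrite permKV.
have eq_maps : map (g \o s) r = map (g \o t) r.
  apply: (sorted_eq leq_trans anti_leq); [exact: r_sorted | exact: r_sorted |].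
  rewrite (map_comp g s) (map_comp g t) perm_map //.
  by rewrite (permPl (r_perm s es)) perm_sym; exact: r_perm.
have k_r : k \in r by rewrite mem_filter e_refl mem_enum.
by move/eq_in_map: eq_maps; apply.
Qed.

(** The moment drops by the product of the weight difference and [g i - g j], both positive. *)
Lemma moment_tperm (g : 'I_m -> nat) (i j : 'I_m) :
  i < j -> g j < g i -> moment (g \o tperm i j) < moment g.
Proof.
move=> lt_ij lt_g; rewrite /moment.
have neq_ji : j != i by rewrite -val_eqE /= gtn_eqF.
rewrite !(bigD1 i isT) /= !(bigD1 j neq_ji) /= tpermL tpermR.
rewrite (eq_bigr (fun k : 'I_m => 2 ^ (m - k.+1) * g k)); last first.
  by move=> k /andP[ki kj]; rewrite tpermD // eq_sym.
have lt_w : 2 ^ (m - j.+1) < 2 ^ (m - i.+1).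
  by rewrite ltn_exp2l //; have := ltn_ord j; lia.
rewrite !addnA ltn_add2r; set a := 2 ^ _ in lt_w *; set b := 2 ^ _ in lt_w *.
by nia.
Qed.

(* The witness minimises the moment among the permutations preserving [e]:      *)
(* a further exchange of two misplaced values would decrease it.                *)
Lemma moment_min_sorted (g : 'I_m -> nat) :
  exists s : 'S_m, [/\ forall i, e i (s i), sorted_in (g \o s),
    moment (g \o s) <= moment g
    & moment (g \o s) = moment g -> sorted_in g].
Proof.
pose P (s : 'S_m) := [forall i, e i (s i)].
have min_sorted (s : 'S_m) : P s ->
    (forall t, P t -> moment (g \o s) <= moment (g \o t)) -> sorted_in (g \o s).
  move=> /forallP Ps s_min i j eij; rewrite leq_eqVlt.
  case/predU1P => [/val_inj->//|lt_ij]; rewrite leqNgt; apply/negP => lt_g.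
  have Pt : P (tperm i j * s)%g.
    apply/forallP => k; rewrite permM.
    case: tpermP => [->|->|_ _]; last exact: Ps.
    - by rewrite (e_ltrans eij).
    - by rewrite -(e_ltrans eij).
  have := s_min _ Pt; rewrite leqNgt; case/negP.
  suff -> : moment (g \o (tperm i j * s)%g) = moment ((g \o s) \o tperm i j).
    exact: moment_tperm.
  by apply: eq_bigr => k _ /=; rewrite permM.
have P1 : P 1%g by apply/forallP => i; rewrite perm1.
have mom1 : moment (g \o (1%g : 'S_m)) = moment g.
  by apply: eq_bigr => i _ /=; rewrite perm1.
case: (arg_minnP (fun s : 'S_m => moment (g \o s)) P1) => s Ps s_min.
exists s; split; [exact/forallP | exact: min_sorted | by rewrite -mom1 s_min |].
move=> eq_mom i j eij le_ij.
(* If the moments agree, the identity is a minimiser too, so [g] itself is sorted. *)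
have := min_sorted 1%g P1; rewrite mom1 -eq_mom => /(_ s_min i j eij le_ij).
by rewrite /= !perm1.
Qed.

(** By uniqueness, [s] yields the same values as the minimiser of [moment_min_sorted]; in the
    equality case it is compared with the identity instead. *)
Lemma sort_moment (g : 'I_m -> nat) (s : 'S_m) :
  (forall i, e i (s i)) -> sorted_in (g \o s) ->
  moment (g \o s) <= moment g /\ (moment (g \o s) = moment g -> g \o s =1 g).
Proof.
move=> es gs_sorted; have [t [et gt_sorted le_mom eq_mom]] := moment_min_sorted g.
have eq_st : moment (g \o s) = moment (g \o t).
  by apply: eq_bigr => i _; rewrite (sorted_in_unique es et).
rewrite eq_st; split=> // /eq_mom g_sorted.
have e1 i : e i ((1%g : 'S_m) i) by rewrite perm1.
have g1_sorted : sorted_in (g \o (1%g : 'S_m)).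
  by move=> i j eij le_ij; rewrite /= !perm1; exact: g_sorted.
by move=> i; rewrite (sorted_in_unique es e1) //= perm1.
Qed.

End Rearrangement.

(** * The potential of a matrix and its behaviour under sorting steps *)

Section Potential.

Variable rev : bool.

Definition row_code m n (A : 'M[bool]_(m, n)) (i : 'I_m) : nat :=
  lex_code rev (row_string A i).

Definition potential m n (A : 'M[bool]_(m, n)) : nat := moment (row_code A).

Lemma rows_sortedE m n (e : rel 'I_m) (A : 'M[bool]_(m, n)) :
  rows_sorted rev e A <-> sorted_in e (row_code A).
Proof.
by split=> A_sorted i i' eii' /(A_sorted i i' eii'); rewrite lex_leE.
Qed.

Lemma row_code_perm m n (s : 'S_m) (A : 'M[bool]_(m, n)) :
  row_code (row_perm s A) =1 row_code A \o s.
Proof.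
move=> i; congr (lex_code rev (tval _)).
by apply: eq_from_tnth => j; rewrite !tnth_mktuple mxE.
Qed.

Lemma row_code_inj m n (A B : 'M[bool]_(m, n)) :
  row_code A =1 row_code B -> A = B.
Proof.
move=> eqAB; apply/matrixP => i j.
have /val_inj eq_row := lex_code_inj (etrans (size_tuple _) (esym (size_tuple _)))
  (eqAB i).
by have := congr1 (fun t : n.-tuple bool => tnth t j) eq_row;
  rewrite !tnth_mktuple.
Qed.

(** Expanding the codes gives a double sum over the entries in which rows and columns play equal
    roles. *)
Lemma potential_tr m n (A : 'M[bool]_(m, n)) : potential A^T = potential A.
Proof.
have potentialE p q (B : 'M[bool]_(p, q)) : potential B =
    \sum_(i < p) \sum_(j < q) (2 ^ (p - i.+1) * 2 ^ (q - j.+1)) * (B i j (+) rev).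
  apply: eq_bigr => i _; rewrite /row_code /lex_code size_tuple big_distrr /=.
  apply: eq_bigr => j _.
  by rewrite (nth_map j) ?size_enum_ord // nth_ord_enum mulnA mulnAC.
rewrite !potentialE exchange_big /=.
by apply: eq_bigr => i _; apply: eq_bigr => j _; rewrite mxE (mulnC (2 ^ _)).
Qed.

Lemma row_sort_step_exists m n (e : rel 'I_m) (A : 'M[bool]_(m, n)) :
  equivalence_rel e -> exists B, row_sort_step rev e A B.
Proof.
move=> eE; have [s [es s_sorted _ _]] := moment_min_sorted eE (row_code A).
exists (row_perm s A), s; split=> //; apply/rows_sortedE => i j eij le_ij.
by rewrite !row_code_perm; exact: s_sorted.
Qed.

Lemma row_sort_step_potential m n (e : rel 'I_m) (A B : 'M[bool]_(m, n)) :
  equivalence_rel e -> row_sort_step rev e A B ->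
  potential B <= potential A /\ (potential B = potential A -> B = A).
Proof.
move=> eE [s [es -> /rows_sortedE s_sorted]].
have [||le_mom eq_mom] := sort_moment eE (g := row_code A) (s := s) => //.
  by move=> i j eij le_ij; have := s_sorted i j eij le_ij; rewrite !row_code_perm.
have -> : potential (row_perm s A) = moment (row_code A \o s).
  by apply: eq_bigr => i _; rewrite row_code_perm.
split=> // /eq_mom eq_code; apply: row_code_inj => i.
by rewrite row_code_perm eq_code.
Qed.

Lemma cols_sorted_tr m n (e : rel 'I_n) (A : 'M[bool]_(m, n)) :
  cols_sorted rev e A <-> rows_sorted rev e A^T.
Proof.
have eq_str j : col_string A j = row_string A^T j.
  by apply: eq_from_tnth => i; rewrite !tnth_mktuple mxE.
by split=> A_sorted j j'; have := A_sorted j j'; rewrite !eq_str.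
Qed.

Lemma col_sort_step_tr m n (e : rel 'I_n) (A B : 'M[bool]_(m, n)) :
  col_sort_step rev e A B <-> row_sort_step rev e A^T B^T.
Proof.
split=> [[s [es -> B_sorted]]|[s [es eqB B_sorted]]]; exists s; split=> //.
- exact: tr_col_perm.
- exact/cols_sorted_tr.
- by apply: trmx_inj; rewrite eqB tr_col_perm.
- exact/cols_sorted_tr.
Qed.

Lemma col_sort_step_exists m n (e : rel 'I_n) (A : 'M[bool]_(m, n)) :
  equivalence_rel e -> exists B, col_sort_step rev e A B.
Proof.
move=> eE; have [B stepB] := row_sort_step_exists A^T eE.
by exists B^T%R; apply/col_sort_step_tr; rewrite trmxK.
Qed.

Lemma col_sort_step_potential m n (e : rel 'I_n) (A B : 'M[bool]_(m, n)) :
  equivalence_rel e -> col_sort_step rev e A B ->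
  potential B <= potential A /\ (potential B = potential A -> B = A).
Proof.
move=> eE /col_sort_step_tr /(row_sort_step_potential eE).
rewrite !potential_tr => -[le_pot eq_pot].
by split=> // /eq_pot /trmx_inj.
Qed.

End Potential.

(** * Termination at a fixed point *)

Lemma nonincreasing_eventually_constant (f : nat -> nat) :
  (forall k, f k.+1 <= f k) -> exists N, forall k, N <= k -> f k = f N.
Proof.
move=> f_dec.
have f_mono i j : i <= j -> f j <= f i.
  elim: j => [|j IHj]; first by rewrite leqn0 => /eqP->.
  by rewrite leq_eqVlt ltnS => /predU1P[->//|/IHj]; exact: leq_trans.
have [v] : exists v, f 0 = v by exists (f 0).
(* The starting index is generalised so that the induction on the value [f N] can restart at any
   later drop. *)
move: {1}0 => N; elim/ltn_ind: v N => v IHv N eq_v.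
have [[k lt_k]|no_drop] := classic (exists k, f k < f N).
  by apply: (IHv (f k) _ k); rewrite -?eq_v.
exists N => k le_Nk; apply/eqP; rewrite eqn_leq f_mono // leqNgt.
by apply/negP => lt_k; apply: no_drop; exists k.
Qed.

Lemma equivalence_sorting_reaches_fixpoint rev m n (er : rel 'I_m)
    (ec : rel 'I_n) (A : 'M[bool]_(m, n)) :
  equivalence_rel er -> equivalence_rel ec ->
  sorting_reaches_fixpoint rev er ec A.
Proof.
move=> erE ecE; split.
  (* Boolean matrices form a finite type, so a sorted successor can be chosen for all of them at
     once. *)
  have [fr frP] := fin_all_exists (fun B : 'M[bool]_(m, n) =>
    row_sort_step_exists rev B erE).
  have [fc fcP] := fin_all_exists (fun B : 'M[bool]_(m, n) =>
    col_sort_step_exists rev B ecE).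
  exists (fix X k :=
    if k is k'.+1 then (if odd k' then fc else fr) (X k') else A).
  by split=> [//|k] /=; case: (odd k); [exact: fcP | exact: frP].
move=> X [_ stepX].
have pot_step k : potential rev (X k.+1) <= potential rev (X k) /\
    (potential rev (X k.+1) = potential rev (X k) -> X k.+1 = X k).
  by have := stepX k; case: ifP => _;
    [exact: col_sort_step_potential | exact: row_sort_step_potential].
have [N pot_N] : exists N, forall k, N <= k ->
    potential rev (X k) = potential rev (X N).
  exact: nonincreasing_eventually_constant (fun k => (pot_step k).1).
have X_N k : N <= k -> X k = X N.
  elim: k => [|k IHk]; first by rewrite leqn0 => /eqP->.
  rewrite leq_eqVlt ltnS => /predU1P[->//|le_Nk].
  by rewrite (pot_step k).2 ?IHk // !pot_N // leqW.
exists N; split=> //.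
(* Step [N.*2] is even, hence a row sort, and its output equals [X N]; the odd step [N.*2.+1] does
   the same for columns. *)
- have le_N : N <= N.*2 by rewrite -addnn leq_addr.
  have := stepX N.*2; rewrite odd_double => -[s [_ _]].
  by rewrite X_N // leqW.
- have le_N : N <= N.*2.+1 by rewrite leqW // -addnn leq_addr.
  have := stepX N.*2.+1; rewrite /= odd_double => -[s [_ _]].
  by rewrite X_N // leqW.
Qed.

Theorem theorem4 (rev : bool) (m n : nat) (A : 'M[bool]_(m, n)) :
  sorting_reaches_fixpoint rev (@any_position m) (@any_position n) A /\
  (forall (P : {set {set 'I_m}}) (Q : {set {set 'I_n}}),
     partition P [set: 'I_m] -> partition Q [set: 'I_n] ->
     sorting_reaches_fixpoint rev (same_part P) (same_part Q) A).
Proof.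
have same_partE p (P : {set {set 'I_p}}) :
    partition P [set: 'I_p] -> equivalence_rel (same_part P).
  move=> partP x y z.
  by apply: (pblock_equivalence partP); rewrite inE.
by split=> [|P Q partP partQ]; apply: equivalence_sorting_reaches_fixpoint;
  rewrite //; exact: same_partE.
Qed.
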